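(* Let $A(t), B(t), C(t)$ be continuous complex $n\times n$ matrix-valued functions on $[t_0;+\infty)$ with $B(t)=B^*(t)$, $C(t)=C^*(t)$ for $t\ge t_0$. Assume that $B(t)\ge0$ for $t\ge t_0$ and that $\sqrt{B(t)}$ is continuously differentiable on $[t_0;+\infty)$. Let $[a;b]\subset[t_0;+\infty)$. Suppose that: 1) $B(t)\ge0$ for $t\in[a;b]$; 9) the matrix equation $$\sqrt{B(t)}A^*(t)-\sqrt{B(t)}'=[\sqrt{B(t)}A^*(t)-\sqrt{B(t)}']\,X\,\sqrt{B(t)}$$ has a continuous solution $X=F(t)$ on $[a;b]$ such that $[\sqrt{B(t)}A^*(t)-\sqrt{B(t)}']F(t)+F^*(t)[A(t)\sqrt{B(t)}-\sqrt{B(t)}']$ is continuously differentiable on $[a;b]$; 10) the scalar equation $$\phi''+\frac{\operatorname{tr}(\mathcal D_F(t))}{n}\phi=0,\qquad t\in[a;b],$$ is oscillatory on $[a;b]$, where $$\mathcal D_F(t)=-H_F'(t)-H_F(t)^2-B(t)C(t),$$ $$H_F(t)=\frac{[\sqrt{B(t)}A^*(t)-\sqrt{B(t)}']F(t)+F^*(t)[A(t)\sqrt{B(t)}-\sqrt{B(t)}']}{2}.$$ Then the hamiltonian system $$\Phi'=A(t)\Phi+B(t)\Psi,\qquad \Psi'=C(t)\Phi-A^*(t)\Psi,\qquad t\ge t_0,$$ is also oscillatory on $[a;b]$.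
   Context: $M^*$ denotes the conjugate transpose of $M$; $H\ge0$ means the hermitian matrix $H$ is non-negative definite; $\sqrt{B(t)}$ is the non-negative definite hermitian square root of $B(t)$ and $\sqrt{B(t)}'$ its derivative in $t$. In the hamiltonian system $\Phi,\Psi$ are unknown continuously differentiable complex $n\times n$ matrix-functions on $[t_0;+\infty)$. A solution $(\Phi,\Psi)$ is called prepared if $\Phi^*(t)\Psi(t)=\Psi^*(t)\Phi(t)$ for $t\ge t_0$. A prepared solution is oscillatory on $[a;b]$ if $\det\Phi(t)$ vanishes at some point of $[a;b]$. The hamiltonian system is oscillatory on $[a;b]$ if every prepared solution is oscillatory on $[a;b]$. The scalar second-order equation is oscillatory on $[a;b]$ if every (real) solution $\phi$ vanishes at some point of $[a;b]$. *)

(* Defs.v *)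
From HB Require Import structures.
From mathcomp Require Import all_boot all_order all_algebra.
From mathcomp Require Import complex.
From mathcomp Require Import all_classical all_reals all_analysis.

Set Implicit Arguments.
Unset Strict Implicit.
Unset Printing Implicit Defensive.

Import Order.TTheory GRing.Theory Num.Theory.
Import numFieldNormedType.Exports.

Local Open Scope ring_scope.
Local Open Scope sesquilinear_scope.
Local Open Scope complex_scope.
Local Open Scope classical_set_scope.

(* The topology of the norm |z|; matrices over R[i] then get the entrywise
   topology of the library. *)
HB.instance Definition _ (R : realType) := PseudoPointedMetric.copy R[i] R[i]^o.

Section HermitianMatrices.
Variables (R : realType) (n : nat).
Implicit Types M S : 'M[R[i]]_n.

(* In R[i], 0 <= z means that z is real and nonnegative. *)
Definition nonneg_def M : Prop :=
  M = M ^t* /\ forall v : 'cV[R[i]]_n, 0 <= (v ^t* *m M *m v) 0 0.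

Definition sqrtmx M : 'M[R[i]]_n :=
  xget 0 [set S | nonneg_def S /\ S *m S = M].

Lemma trmxC_mul m p q (X : 'M[R[i]]_(m, p)) (Y : 'M[R[i]]_(p, q)) :
  (X *m Y) ^t* = Y ^t* *m X ^t*.
Proof. by rewrite trmx_mul map_mxM. Qed.

Lemma sqrtmxP M :
  nonneg_def M -> nonneg_def (sqrtmx M) /\ sqrtmx M *m sqrtmx M = M.
Proof.
move=> [Mherm Mge0].
suff: exists S, [set S | nonneg_def S /\ S *m S = M] S.
  by move/(@xgetPex _ 0) => h; apply: h.
have /orthomx_spectralP : M \is normalmx by apply/normalmxP; rewrite -Mherm.
have := spectral_unitarymx M.
set P := spectralmx M; set d := spectral_diag M => Punit.
rewrite invmx_unitary // => ME.
have PPt : P *m P ^t* = 1%:M by apply/unitarymxP.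
have d_ge0 k : 0 <= d 0 k.
  have := Mge0 (P ^t* *m delta_mx k 0).
  rewrite {1}ME trmxC_mul trmxCK !mulmxA.
  rewrite -(mulmxA _ P (P ^t*)) PPt mulmx1 -(mulmxA _ P (P ^t*)) PPt mulmx1.
  rewrite trmx_delta map_delta_mx -rowE -colE !mxE eqxx mulr1n.
  by [].
pose r : 'rV[R[i]]_n := \row_k sqrtC (d 0 k).
have r_ge0 k : 0 <= r 0 k by rewrite mxE sqrtC_ge0.
exists (P ^t* *m diag_mx r *m P); split; first split.
- rewrite !trmxC_mul trmxCK mulmxA tr_diag_mx map_diag_mx.
  congr (_ *m diag_mx _ *m _); apply/rowP => k.
  by rewrite [RHS]mxE; apply: esym; apply: (geC0_conj (r_ge0 k)).
- move=> v; set w := P *m v.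
  have -> : v ^t* *m (P ^t* *m diag_mx r *m P) *m v = w ^t* *m diag_mx r *m w.
    by rewrite /w trmxC_mul !mulmxA.
  rewrite mul_mx_diag mxE sumr_ge0 // => k _.
  rewrite !mxE mulrAC mulr_ge0 ?sqrtC_ge0 // mulrC; exact: mul_conjC_ge0.
- rewrite [RHS]ME !mulmxA; congr (_ *m _).
  rewrite -(mulmxA _ P (P ^t*)) PPt mulmx1 -mulmxA mulmx_diag.
  congr (_ *m diag_mx _); apply/rowP => k.
  by rewrite !mxE -expr2 sqrtCK.
Qed.

End HermitianMatrices.

(* All derivatives are taken within a set D, so that they are one-sided at the
   endpoints of the intervals [t0, +oo[ and [a, b]. *)
Section MatrixDerivative.
Variables (R : realType) (n : nat) (D : set R).
Implicit Types M : R -> 'M[R[i]]_n.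

Definition mx_quotient M (t s : R) : 'M[R[i]]_n :=
  ((s - t)^-1)%:C *: (M s - M t).

Definition mx_derivable_in M (t : R) : Prop :=
  cvg (mx_quotient M t s @[s --> within D t^']).

Definition mx_deriv_in M (t : R) : 'M[R[i]]_n :=
  lim (mx_quotient M t s @[s --> within D t^']).

Definition mx_C1_in M : Prop :=
  (forall t, D t -> mx_derivable_in M t) /\
  {within D, continuous (mx_deriv_in M)}.

End MatrixDerivative.

Section ScalarEquation.
Variables (R : realType) (a b : R).
Implicit Types phi : R -> R.

Definition derivable_in (D : set R) phi (t : R) : Prop :=
  cvg ((s - t)^-1 * (phi s - phi t) @[s --> within D t^']).

Definition deriv_in (D : set R) phi (t : R) : R :=
  lim ((s - t)^-1 * (phi s - phi t) @[s --> within D t^']).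

(* Real solutions of phi'' + q phi = 0 on [a, b]. The coefficient is given as a
   complex number because it is used for traces of complex matrices. *)
Definition scalar_solution (q : R -> R[i]) phi : Prop :=
  let D := `[a, b]%classic in
  let phi' := deriv_in D phi in
  forall t, a <= t <= b ->
    [/\ derivable_in D phi t, derivable_in D phi' t &
        (deriv_in D phi' t)%:C + q t * (phi t)%:C = 0].

Definition scalar_oscillatory (q : R -> R[i]) : Prop :=
  forall phi, scalar_solution q phi -> exists2 t, a <= t <= b & phi t = 0.

End ScalarEquation.

Section HamiltonianSystem.
Variables (R : realType) (n : nat) (t0 : R).
Variables A B C : R -> 'M[R[i]]_n.
Implicit Types Phi Psi : R -> 'M[R[i]]_n.

Definition hamiltonian_solution Phi Psi : Prop :=
  let D := `[t0, +oo[%classic in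
  [/\ mx_C1_in D Phi, mx_C1_in D Psi &
      forall t, t0 <= t ->
        mx_deriv_in D Phi t = A t *m Phi t + B t *m Psi t /\
        mx_deriv_in D Psi t = C t *m Phi t - A t ^t* *m Psi t].

Definition prepared Phi Psi : Prop :=
  forall t, t0 <= t -> Phi t ^t* *m Psi t = Psi t ^t* *m Phi t.

Definition hamiltonian_oscillatory (a b : R) : Prop :=
  forall Phi Psi, hamiltonian_solution Phi Psi -> prepared Phi Psi ->
    exists2 t, a <= t <= b & \det (Phi t) = 0.

End HamiltonianSystem.

Section Coefficients.
Variables (R : realType) (n : nat) (t0 a b : R).
Variables A B C F : R -> 'M[R[i]]_n.

Definition sqrtB (t : R) : 'M[R[i]]_n := sqrtmx (B t).

Definition sqrtB' : R -> 'M[R[i]]_n := mx_deriv_in `[t0, +oo[%classic sqrtB.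

Definition H_F (t : R) : 'M[R[i]]_n :=
  2^-1 *: ((sqrtB t *m A t ^t* - sqrtB' t) *m F t +
           F t ^t* *m (A t *m sqrtB t - sqrtB' t)).

Definition D_F (t : R) : 'M[R[i]]_n :=
  - mx_deriv_in `[a, b]%classic H_F t - H_F t *m H_F t - B t *m C t.

End Coefficients.

(* Main.v *)
Require Import Defs.
From HB Require Import structures.
From mathcomp Require Import all_boot all_order all_algebra.
From mathcomp Require Import complex ring lra.
From mathcomp Require Import all_classical all_reals all_analysis.
From mathcomp Require Import measurable_realfun.

Set Implicit Arguments.
Unset Strict Implicit.
Unset Printing Implicit Defensive.

Import Order.TTheory GRing.Theory Num.Theory.
Import numFieldNormedType.Exports.

Local Open Scope ring_scope.
Local Open Scope sesquilinear_scope.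
Local Open Scope complex_scope.
Local Open Scope classical_set_scope.

(** If det Phi has no zero on [a, b], then Y = Psi Phi^-1 is hermitian and
    solves Y' = C - A^* Y - Y A - Y B Y. With S = sqrt B and G = S A^* - S',
    the matrix Z = S Y S satisfies Z' = S C S - G Y S - S Y G^* - Z^2, and G =
    G F S turns G Y S into G F Z. The trace of G F Z + Z F^* G^* is 2 tr(H_F
    Z), so for W = Z + H_F completing the square gives tr W' = - tr D_F - tr
    W^2. Hence w = tr W / n satisfies w' + w^2 + r = - tr D_F / n, where r = tr
    W^2 / n - w^2 >= 0. Put u = exp(int w), so that u'' = (w' + w^2) u, and
    look for a solution phi = u v of phi'' = (w' + w^2 + r) phi: this amounts
    to (u^2 v')' = u^2 r v, whose Volterra form has a nonnegative kernel, so
    Picard iteration from v = 1 increases to a solution with v >= 1. Then phi >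
    0, which contradicts the oscillation of the scalar equation. *)

(** * Limits of complex matrices *)

Lemma norm_conjB (C : numClosedFieldType) (x y : C) :
  `|Num.conj x - Num.conj y| = `|x - y|.
Proof. by rewrite -rmorphB norm_conjC. Qed.

Section ComplexMatrixLimits.
Variables (R : realType) (T : Type) (F : set_system T).
Context {FF : Filter F}.

(** A positive element of [R[i]] has zero imaginary part, so real radii suffice to test
    convergence. *)
Lemma cvgc_dist (f : T -> R[i]) (x : R[i]) :
  f @ F --> x <-> (forall e : R, 0 < e -> \forall s \near F, `|x - f s| < e%:C).
Proof.
split=> [/(@cvgrPdist_lt R[i] R[i]^o) h e e0|h].
  by apply: h; rewrite ltcR.
apply/(@cvgrPdist_lt R[i] R[i]^o) => -[e d].
rewrite ltcE /= => /andP[/eqP d0 e0].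
by move: d0 e0 => -> e0; exact: h.
Qed.

Lemma cvgcD (f g : T -> R[i]) (x y : R[i]) :
  f @ F --> x -> g @ F --> y -> (fun s => f s + g s) @ F --> x + y.
Proof. exact: (@cvgD R[i] R[i]^o). Qed.

Lemma cvgcM (f g : T -> R[i]) (x y : R[i]) :
  f @ F --> x -> g @ F --> y -> (fun s => f s * g s) @ F --> x * y.
Proof. exact: cvgM. Qed.

Lemma cvgc_sum (I : Type) (r : seq I) (P : pred I)
    (f : I -> T -> R[i]) (x : I -> R[i]) :
  (forall k, P k -> f k @ F --> x k) ->
  (fun s => \sum_(k <- r | P k) f k s) @ F --> \sum_(k <- r | P k) x k.
Proof.
move=> fx; elim: r => [|k r IHr].
  by under eq_fun do rewrite big_nil; rewrite big_nil; exact: cvg_cst.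
under eq_fun do rewrite big_cons; rewrite big_cons.
case: ifP => [Pk|_]; last exact: IHr.
by have := cvgcD (fx k Pk) IHr; exact.
Qed.

Lemma cvgc_prod (I : Type) (r : seq I) (P : pred I)
    (f : I -> T -> R[i]) (x : I -> R[i]) :
  (forall k, P k -> f k @ F --> x k) ->
  (fun s => \prod_(k <- r | P k) f k s) @ F --> \prod_(k <- r | P k) x k.
Proof.
move=> fx; elim: r => [|k r IHr].
  by under eq_fun do rewrite big_nil; rewrite big_nil; exact: cvg_cst.
under eq_fun do rewrite big_cons; rewrite big_cons.
case: ifP => [Pk|_]; last exact: IHr.
by have := cvgcM (fx k Pk) IHr; exact.
Qed.

Lemma cvgc_conj (f : T -> R[i]) (x : R[i]) :
  f @ F --> x -> (fun s => Num.conj (f s)) @ F --> Num.conj x.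
Proof.
move=> /cvgc_dist fx; apply/cvgc_dist => e e0.
by have := fx e e0; apply: filterS => s; rewrite (norm_conjB x (f s)).
Qed.

Lemma cvgc_Re (f : T -> R[i]) (x : R[i]) :
  f @ F --> x -> (fun s => complex.Re (f s)) @ F --> complex.Re x.
Proof.
move=> /cvgc_dist fx; apply/cvgrPdist_lt => e e0.
have := fx e e0; apply: filterS => s; rewrite -ltcR; apply: le_lt_trans.
by have := normc_ge_Re (x - f s); rewrite raddfB.
Qed.

Lemma cvg_real_complex (f : T -> R) (x : R) :
  f @ F --> x -> (fun s => (f s)%:C) @ F --> x%:C.
Proof.
move=> /cvgrPdist_lt fx; apply/cvgc_dist => e e0.
have := fx e e0; apply: filterS => s.
by rewrite -rmorphB normc_def /= expr0n addr0 sqrtr_sqr ltcR.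
Qed.

Lemma cvg_mxP m n (f : T -> 'M[R[i]]_(m, n)) (M : 'M[R[i]]_(m, n)) :
  f @ F --> M <-> forall i j, (fun s => f s i j) @ F --> M i j.
Proof.
split=> [fM i j|fM].
  have := cvg_comp _ _ fM (@coord_continuous R[i] m n i j M); exact.
move=> A /= [P MP PA].
have : \forall s \near F, forall i j, P i j (f s i j).
  apply: filter_forall => i; apply: filter_forall => j.
  by have := fM i j (P i j) (MP i j); exact.
apply: (@filterS _ F) => s Ps; exact: PA.
Qed.

Lemma cvgc_unique {PF : ProperFilter F} (f : T -> R[i]) (x y : R[i]) :
  f @ F --> x -> f @ F --> y -> x = y.
Proof. by apply: cvg_unique; exact: (@norm_hausdorff _ R[i]^o). Qed.

Lemma cvg_mx_unique {PF : ProperFilter F} m n (f : T -> 'M[R[i]]_(m, n))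
    (M N : 'M[R[i]]_(m, n)) :
  f @ F --> M -> f @ F --> N -> M = N.
Proof.
move=> /cvg_mxP fM /cvg_mxP fN; apply/matrixP => i j.
exact: cvgc_unique (fM i j) (fN i j).
Qed.

Lemma cvg_mx_near m n (f g : T -> 'M[R[i]]_(m, n)) (M : 'M[R[i]]_(m, n)) :
  (\forall s \near F, f s = g s) -> f @ F --> M -> g @ F --> M.
Proof. by move=> fg; apply: cvg_trans; apply: near_eq_cvg. Qed.

Lemma cvg_mxD m n (f g : T -> 'M[R[i]]_(m, n)) (M N : 'M[R[i]]_(m, n)) :
  f @ F --> M -> g @ F --> N -> (fun s => f s + g s) @ F --> M + N.
Proof.
move=> /cvg_mxP fM /cvg_mxP gN; apply/cvg_mxP => i j.
under eq_fun do rewrite mxE; rewrite mxE.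
by have := cvgcD (fM i j) (gN i j); exact.
Qed.

Lemma cvg_mxN m n (f : T -> 'M[R[i]]_(m, n)) (M : 'M[R[i]]_(m, n)) :
  f @ F --> M -> (fun s => - f s) @ F --> - M.
Proof.
move=> /cvg_mxP fM; apply/cvg_mxP => i j.
under eq_fun do rewrite mxE; rewrite mxE.
by have := @cvgN R[i] R[i]^o _ _ _ _ _ (fM i j); exact.
Qed.

Lemma cvg_mulmx m n p (f : T -> 'M[R[i]]_(m, n)) (g : T -> 'M[R[i]]_(n, p))
    (M : 'M[R[i]]_(m, n)) (N : 'M[R[i]]_(n, p)) :
  f @ F --> M -> g @ F --> N -> (fun s => f s *m g s) @ F --> M *m N.
Proof.
move=> /cvg_mxP fM /cvg_mxP gN; apply/cvg_mxP => i j.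
under eq_fun do rewrite mxE; rewrite mxE.
apply: cvgc_sum => k _; by have := cvgcM (fM i k) (gN k j); exact.
Qed.

Lemma cvg_scalemx m n (f : T -> R[i]) (g : T -> 'M[R[i]]_(m, n))
    (x : R[i]) (M : 'M[R[i]]_(m, n)) :
  f @ F --> x -> g @ F --> M -> (fun s => f s *: g s) @ F --> x *: M.
Proof.
move=> fx /cvg_mxP gM; apply/cvg_mxP => i j.
under eq_fun do rewrite mxE; rewrite mxE.
by have := cvgcM fx (gM i j); exact.
Qed.

Lemma cvg_trmxC m n (f : T -> 'M[R[i]]_(m, n)) (M : 'M[R[i]]_(m, n)) :
  f @ F --> M -> (fun s => f s ^t*) @ F --> M ^t*.
Proof.
move=> /cvg_mxP fM; apply/cvg_mxP => i j.
under eq_fun do rewrite !mxE; rewrite !mxE.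
by have := cvgc_conj (fM j i); exact.
Qed.

Lemma cvg_mxtrace n (f : T -> 'M[R[i]]_n) (M : 'M[R[i]]_n) :
  f @ F --> M -> (fun s => \tr (f s)) @ F --> \tr M.
Proof. by move=> /cvg_mxP fM; apply: cvgc_sum => i _. Qed.

Lemma cvg_det n (f : T -> 'M[R[i]]_n) (M : 'M[R[i]]_n) :
  f @ F --> M -> (fun s => \det (f s)) @ F --> \det M.
Proof.
move=> /cvg_mxP fM; apply: cvgc_sum => s _; apply: cvgcM; first exact: cvg_cst.
by apply: cvgc_prod => i _.
Qed.

(** Cramer's rule: the entries of the adjugate are polynomials in those of the matrix. [invmx] is
    defined by this formula on invertible matrices only, hence the condition along the filter. *)
Lemma cvg_invmx n (f : T -> 'M[R[i]]_n) (M : 'M[R[i]]_n) :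
  M \in unitmx -> (\forall s \near F, f s \in unitmx) ->
  f @ F --> M -> (fun s => invmx (f s)) @ F --> invmx M.
Proof.
move=> Mu fu fM.
have : (fun s => (\det (f s))^-1 *: \adj (f s)) @ F --> (\det M)^-1 *: \adj M.
  apply: cvg_scalemx.
    by apply: cvgV (cvg_det fM); rewrite -unitfE -unitmxE.
  apply/cvg_mxP => i j; under eq_fun do rewrite mxE; rewrite mxE.
  apply: cvgcM; first exact: cvg_cst.
  apply: cvg_det; apply/cvg_mxP => k l.
  under eq_fun do rewrite !mxE; rewrite !mxE.
  by move/cvg_mxP: fM; exact.
rewrite {2}/invmx Mu; apply: cvg_mx_near.
by apply: filterS fu => s; rewrite /invmx => ->.
Qed.

End ComplexMatrixLimits.

(** * Derivatives of matrices within a set *)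

Lemma cvg_within_dnbhs (R : realType) (D : set R) (t : R) :
  within D t^' --> nbhs t.
Proof. exact: cvg_trans (cvg_within _) (@cvg_within _ _ _ _). Qed.

(** Every point of a nondegenerate interval, endpoints included, is a limit of other points of it;
    this makes derivatives within [[a, b]] unique. *)
Lemma within_itv_proper (R : realType) (a b t : R) :
  a < b -> a <= t <= b -> ProperFilter (within `[a, b]%classic t^').
Proof.
move=> ab /andP[leat letb]; apply: Build_ProperFilter_ex => P.
move=> /nbhs_ballP[e /= e0 eP].
suff [d [de d0 abd]] : exists d,
    [/\ `|d| < e, d != 0 & `[a, b]%classic (t + d)].
  exists (t + d); apply: (eP _ _ _ abd); last by rewrite addrC -subr_eq0 addrK.
  by rewrite /ball /= opprD addNKr normrN.
(* Move right inside the room left below [b], or left when [t = b]; half of the minimum with [e]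
   stays in the ball. *)
have [tb|bt] := ltP t b.
  have m0 : 0 < Num.min e (b - t) by rewrite lt_min e0 subr_gt0.
  have /andP[? ?] : (Num.min e (b - t) <= e) && (Num.min e (b - t) <= b - t).
    by rewrite !ge_min !lexx orbT.
  exists (Num.min e (b - t) / 2); rewrite gtr0_norm ?divr_gt0//; split.
  - by lra.
  - by lra.
  - by rewrite /= in_itv /=; lra.
have m0 : 0 < Num.min e (t - a) by rewrite lt_min e0 subr_gt0; lra.
have /andP[? ?] : (Num.min e (t - a) <= e) && (Num.min e (t - a) <= t - a).
  by rewrite !ge_min !lexx orbT.
exists (- (Num.min e (t - a) / 2)); rewrite normrN gtr0_norm ?divr_gt0//; split.
- by lra.
- by lra.
- by rewrite /= in_itv /=; lra.
Qed.

Section WithinDerivative.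
Variables (R : realType) (n : nat) (D : set R) (t : R).
Implicit Types M N : R -> 'M[R[i]]_n.
Local Notation F := (within D t^').

(** The derivative as a relation: the rules of calculus compose without [lim], and properness of the
    filter is asked only where uniqueness matters. *)
Definition is_mx_deriv M (L : 'M[R[i]]_n) := mx_quotient M t s @[s --> F] --> L.

Lemma mx_derivable_inP M :
  mx_derivable_in D M t -> is_mx_deriv M (mx_deriv_in D M t).
Proof. by []. Qed.

Lemma is_mx_derivP M L : is_mx_deriv M L -> mx_derivable_in D M t.
Proof. by move=> ML; apply/cvg_ex; exists L; exact: ML. Qed.

Lemma near_within_dnbhs_neq : \forall s \near F, s != t.
Proof. exact: cvg_within (nbhs_dnbhs_neq t). Qed.

(** Away from [t], [M s] is [M t] plus [s - t] times the quotient, and the second term tends to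
    [0 *: L]. *)
Lemma is_mx_deriv_cvg M L : is_mx_deriv M L -> M s @[s --> F] --> M t.
Proof.
move=> ML.
have h : (fun s => (s - t)%:C) @ F --> (0 : R[i]).
  rewrite -(rmorph0 (real_complex R)) -(subrr t); apply: cvg_real_complex.
  apply: cvgB; last exact: cvg_cst.
  exact: cvg_within_dnbhs.
have : (fun s => M t + (s - t)%:C *: mx_quotient M t s) @ F --> M t + 0 *: L.
  by apply: cvg_mxD; [exact: cvg_cst|exact: cvg_scalemx].
rewrite scale0r addr0; apply: cvg_mx_near.
apply: filterS near_within_dnbhs_neq => s st.
rewrite /mx_quotient scalerA -rmorphM mulfV ?subr_eq0// scale1r.
by rewrite subrKC.
Qed.

Lemma is_mx_derivD M N L K :
  is_mx_deriv M L -> is_mx_deriv N K ->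
  is_mx_deriv (fun s => M s + N s) (L + K).
Proof.
move=> ML NK; apply: cvg_mx_near (cvg_mxD ML NK); apply: nearW => s.
by rewrite /mx_quotient -scalerDr addrACA -opprD.
Qed.

Lemma is_mx_derivZ (k : R[i]) M L :
  is_mx_deriv M L -> is_mx_deriv (fun s => k *: M s) (k *: L).
Proof.
move=> ML; apply: cvg_mx_near (cvg_scalemx (cvg_cst k) ML); apply: nearW => s.
by rewrite /mx_quotient -scalerBr !scalerA mulrC.
Qed.

Lemma is_mx_derivM M N L K :
  is_mx_deriv M L -> is_mx_deriv N K ->
  is_mx_deriv (fun s => M s *m N s) (L *m N t + M t *m K).
Proof.
move=> ML NK; have Ns := is_mx_deriv_cvg NK.
apply: cvg_mx_near (cvg_mxD (cvg_mulmx ML Ns) (cvg_mulmx (cvg_cst (M t)) NK)).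
apply: nearW => s.
rewrite /mx_quotient -scalemxAl -scalemxAr -scalerDr mulmxBl mulmxBr.
by rewrite addrA subrK.
Qed.

Lemma is_mx_deriv_trmxC M L :
  is_mx_deriv M L -> is_mx_deriv (fun s => M s ^t*) (L ^t*).
Proof.
move=> ML; apply: cvg_mx_near (cvg_trmxC ML); apply: nearW => s.
apply/matrixP => i j; rewrite !mxE rmorphM rmorphB /=.
by congr (_ * _); exact: conjc_real.
Qed.

(** From X^-1 - Y^-1 = - X^-1 (X - Y) Y^-1 with X = [M s], Y = [M t], and continuity of the
    inverse. *)
Lemma is_mx_deriv_inv M L :
  (forall s, D s -> M s \in unitmx) -> D t -> is_mx_deriv M L ->
  is_mx_deriv (fun s => invmx (M s)) (- (invmx (M t) *m L *m invmx (M t))).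
Proof.
move=> Mu Dt ML.
have Vs : (fun s => invmx (M s)) @ F --> invmx (M t).
  apply: cvg_invmx; [exact: Mu| |exact: is_mx_deriv_cvg ML].
  exact: filterS Mu (near_withinT D (dnbhs_filter t)).
apply: cvg_mx_near
  (cvg_mxN (cvg_mulmx (cvg_mulmx Vs ML) (cvg_cst (invmx (M t))))).
apply: filterS (near_withinT D (dnbhs_filter t)) => s Ds.
rewrite /mx_quotient -scalemxAr -scalemxAl mulmxBr mulmxBl mulVmx ?Mu//.
by rewrite -mulmxA mulmxV ?Mu// mulmx1 mul1mx -scalerN opprB.
Qed.

Lemma is_mx_deriv_unique {PF : ProperFilter F} M L K :
  is_mx_deriv M L -> is_mx_deriv M K -> L = K.
Proof. exact: cvg_mx_unique. Qed.

(** On [D], [M] and [M ^t*] have the same quotients, whose limit is unique. *)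
Lemma is_mx_deriv_herm {PF : ProperFilter F} M L :
  (forall s, D s -> M s = M s ^t*) -> D t -> is_mx_deriv M L -> L = L ^t*.
Proof.
move=> MH Dt ML; apply: (is_mx_deriv_unique ML).
apply: cvg_mx_near (is_mx_deriv_trmxC ML).
apply: filterS (near_withinT D (dnbhs_filter t)) => s Ds.
by rewrite /mx_quotient -!MH.
Qed.

Lemma is_mx_deriv_Re_trace M L : is_mx_deriv M L ->
  (s - t)^-1 * (complex.Re (\tr (M s)) - complex.Re (\tr (M t))) @[s --> F] -->
  complex.Re (\tr L).
Proof.
move=> /cvg_mxtrace /cvgc_Re; apply: cvg_trans; apply: near_eq_cvg.
apply: nearW => s; rewrite /mx_quotient mxtraceZ raddfB /=.
by case: (\tr (M s)) (\tr (M t)) => [x y] [x' y'] /=; rewrite mul0r subr0.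
Qed.

End WithinDerivative.

(** Passes from derivatives on [[t0, +oo[] to those on [[a, b]], which are one-sided at both
    endpoints. *)
Lemma is_mx_deriv_subset (R : realType) n (D E : set R) t
    (M : R -> 'M[R[i]]_n) L :
  D `<=` E -> is_mx_deriv E t M L -> is_mx_deriv D t M L.
Proof.
move=> DE ML A NA.
have h : \forall s \near t^', E s -> A (mx_quotient M t s) by exact: ML.
have : \forall s \near t^', D s -> A (mx_quotient M t s).
  by apply: filterS h => s As /DE.
exact.
Qed.

(** * A monotone Volterra equation *)

Lemma within_continuousM (R : realType) (A : set R) (f g : R -> R) :
  {within A, continuous f} -> {within A, continuous g} ->
  {within A, continuous (fun x => f x * g x)}.
Proof. by move=> cf cg x; apply: continuousM; [exact: cf|exact: cg]. Qed.

Section Volterra.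
Context {R : realType}.
Variables (a b m : R) (P Q : R -> R).
Hypothesis ab : a < b.
Hypotheses (cP : {within `[a, b], continuous P})
  (cQ : {within `[a, b], continuous Q}).
Hypotheses (P_ge0 : forall x, 0 <= P x) (Q_ge0 : forall x, 0 <= Q x).
Hypothesis m_gt0 : 0 < m.
Hypotheses (P_le : forall x, a <= x <= b -> P x <= m)
           (Q_le : forall x, a <= x <= b -> Q x <= m).

Local Notation mu := (@lebesgue_measure R).
Local Notation continuous_ab f := {within `[a, b], continuous (f : R -> R)}.
Local Notation integrable_ab f := (mu.-integrable `[a, b] (EFin \o f)).
Implicit Types (f g : R -> R) (t : R).
Let J (f : R -> R) t := \int[mu]_(x in `[a, t]) f x.
(** Integrated form of v' = P g, g' = Q v, v(a) = 1, g(a) = 0: the inner [J] is g, and a solution v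
    is a fixed point. *)
Let K (f : R -> R) t := 1 + J (fun x => P x * J (fun y => Q y * f y) x) t.
(* Since P, Q <= m, e is a supersolution: K e <= e. *)
Let e t := expR (m * (t - a)).

Let sub_ab t : a <= t <= b -> `[a, t]%classic `<=` `[a, b]%classic.
Proof.
by move=> /andP[_ tb] x /=; rewrite !in_itv /= => /andP[-> /le_trans]; apply.
Qed.

Let intS f t : a <= t <= b -> integrable_ab f ->
  mu.-integrable `[a, t] (EFin \o f).
Proof. by move=> tab; apply: integrableS => //; exact: sub_ab. Qed.

Let cont_int f : continuous_ab f -> integrable_ab f.
Proof.
move=> cf; apply: continuous_compact_integrable => //.
exact: segment_compact.
Qed.

Let cont_sub f : continuous f -> continuous_ab f.
Proof. by move=> cf; exact: continuous_subspaceT. Qed.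

Let J_cont f : integrable_ab f -> continuous_ab (J f).
Proof.
by move=> fi; apply: parameterized_integral_continuous => //; exact: ltW.
Qed.

Let J_le f g t : integrable_ab f -> integrable_ab g ->
  (forall x, a <= x <= b -> f x <= g x) -> a <= t <= b -> J f t <= J g t.
Proof.
move=> fi gi fg tab; apply: le_Rintegral => //; [exact: intS|exact: intS|].
by move=> x /(sub_ab tab) /=; rewrite in_itv /=; exact: fg.
Qed.

Let J_ge0 f t : (forall x, a <= x <= b -> 0 <= f x) ->
  a <= t <= b -> 0 <= J f t.
Proof.
move=> f0 tab; apply: Rintegral_ge0 => x /(sub_ab tab) /=.
by rewrite in_itv /=; exact: f0.
Qed.

Let e_derive t : is_derive (t : R) (1 : R) e (m * e t).
Proof.
rewrite /e; apply: is_derive_eq.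
by rewrite /GRing.scale /=; ring.
Qed.

Let e_cont : continuous e.
Proof.
move=> t; have ? := e_derive t.
by apply: differentiable_continuous; exact/derivable1_diffP.
Qed.

Let J_e t : a <= t <= b -> J (fun x => m * e x) t = e t - 1.
Proof.
(* The fundamental theorem needs [a < t]; at [t = a] both sides vanish. *)
move=> /andP[]; rewrite le_eqVlt => /predU1P[<- _|at_ tb].
  by rewrite /J set_itv1 Rintegral_set1 /e subrr mulr0 expR0 subrr.
rewrite /J /Rintegral (@continuous_FTC2 _ _ e)//=.
- by rewrite /e subrr mulr0 expR0.
- apply: continuous_subspaceT => x.
  by apply: continuousM; [exact: cvg_cst|exact: e_cont].
- split.
  + by move=> x _.
  + by apply: cvg_at_right_filter; exact: e_cont.
  + by apply: cvg_at_left_filter; exact: e_cont.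
- by move=> x _; have ? := e_derive x; rewrite derive1E derive_val.
Qed.

Let e_ge1 t : a <= t <= b -> 1 <= e t.
Proof.
by move=> /andP[at_ _]; rewrite -expR0 ler_expR mulr_ge0 ?subr_ge0// ltW.
Qed.

Let KI f : integrable_ab (fun x => Q x * f x) ->
  integrable_ab (fun x => P x * J (fun y => Q y * f y) x).
Proof.
by move=> fi; apply/cont_int/within_continuousM; [exact: cP|exact: J_cont].
Qed.

Let K_cont f : integrable_ab (fun x => Q x * f x) -> continuous_ab (K f).
Proof.
move=> /KI/J_cont fi x; apply: (@continuousD R R); [exact: cvg_cst|exact: fi].
Qed.

Let QI f : continuous_ab f -> integrable_ab (fun x => Q x * f x).
Proof. by move=> fi; apply/cont_int/within_continuousM. Qed.

Let K_le f g t : continuous_ab f -> continuous_ab g ->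
  (forall x, a <= x <= b -> f x <= g x) -> a <= t <= b -> K f t <= K g t.
Proof.
move=> cf cg fg tab; rewrite lerD2l.
apply: J_le => //; [exact/KI/QI|exact/KI/QI|].
move=> x xab; apply: ler_wpM2l => //.
apply: J_le => //; [exact/QI|exact/QI|move=> y yab].
by apply: ler_wpM2l => //; exact: fg.
Qed.

Let K_ge1 f t : (forall x, a <= x <= b -> 0 <= f x) ->
  a <= t <= b -> 1 <= K f t.
Proof.
move=> f0 tab; rewrite lerDl; apply: J_ge0 => // x xab; apply: mulr_ge0 => //.
by apply: J_ge0 => // y yab; apply: mulr_ge0 => //; exact: f0.
Qed.

(** The inner integral is at most that of [m * e], which is [e - 1 <= e]; the outer integrand is
    then at most [m * e] and integrates to at most [e - 1] again. *)
Let K_e t : a <= t <= b -> K e t <= e t.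
Proof.
have ei : integrable_ab (fun x => m * e x).
  apply/cont_int/cont_sub => x.
  by apply: continuousM; [exact: cvg_cst|exact: e_cont].
have ce := cont_sub e_cont.
move=> tab; rewrite -lerBrDl -J_e//; apply: J_le => //; first exact/KI/QI.
move=> x xab; apply: ler_pM => //.
- by apply: J_ge0 => // y yab; rewrite mulr_ge0// expR_ge0.
- exact: P_le.
apply: (@le_trans _ _ (J (fun x => m * e x) x)).
  apply: J_le => //; first exact: QI.
  by move=> y yab; rewrite ler_wpM2r ?expR_ge0// Q_le.
by rewrite J_e// gerBl.
Qed.

Let v_ k := iter k K (cst 1).

(** [K] is monotone, so [v_ 0 <= v_ 1] propagates along the Picard iterates, and [K e <= e] keeps
    them below [e]. *)
Let v_prop k : [/\ continuous_ab (v_ k),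
  forall t, a <= t <= b -> 1 <= v_ k t <= e t &
  forall t, a <= t <= b -> v_ k t <= v_ k.+1 t].
Proof.
elim: k => [|k [cv v1 vv]].
  have c1 : continuous_ab (v_ 0) by apply: cont_sub => x; exact: cvg_cst.
  split => // t tab; first by rewrite /= lexx e_ge1.
  by apply: K_ge1.
have cv1 : continuous_ab (v_ k.+1) by exact/K_cont/QI.
split=> [//|t tab|t tab].
  apply/andP; split.
    by apply: K_ge1 => // x /v1 /andP[+ _]; exact: le_trans.
  apply: le_trans (K_e tab); apply: K_le => //; first exact: cont_sub.
  by move=> x /v1 /andP[].
exact: K_le.
Qed.

Let v t := limn (v_ ^~ t).

Let v_cvg t : a <= t <= b -> v_ ^~ t @ \oo --> v t.
Proof.
move=> tab; apply: nondecreasing_is_cvgn.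
  by apply/nondecreasing_seqP => k; have [_ _] := v_prop k; exact.
exists (e t) => _ [k _ <-].
by have [_ /(_ t tab)/andP[]] := v_prop k.
Qed.

Let v_itv t : a <= t <= b -> 1 <= v t <= e t.
Proof.
move=> tab; have vc := v_cvg tab; apply/andP; split.
  apply: limr_ge; first by apply/cvg_ex; exists (v t).
  by apply: nearW => k; have [_ /(_ t tab)/andP[]] := v_prop k.
apply: limr_le; first by apply/cvg_ex; exists (v t).
by apply: nearW => k; have [_ /(_ t tab)/andP[]] := v_prop k.
Qed.


(** Dominated convergence with a constant majorant. Integrability of the limit belongs to the
    conclusion, since the limit of the iterates is not yet known to be continuous. *)
Let J_cvg (f_ : nat -> R -> R) f (c : R) : (forall k, integrable_ab (f_ k)) ->
  (forall x, a <= x <= b -> f_ ^~ x @ \oo --> f x) ->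
  (forall k x, a <= x <= b -> `|f_ k x| <= c) ->
  integrable_ab f /\ forall t, a <= t <= b -> J (f_ k) t @[k --> \oo] --> J f t.
Proof.
move=> fi fc fle.
have DC t : a <= t <= b -> mu.-integrable `[a, t] (EFin \o f) /\
    J (f_ k) t @[k --> \oo] --> J f t.
  move=> tab.
  have mf_ k : measurable_fun `[a, t] (f_ k).
    by have /(intS tab)/integrableP[/measurable_EFinP] := fi k.
  have fct x : `[a, t]%classic x -> f_ ^~ x @ \oo --> f x.
    by move=> /(sub_ab tab); rewrite /= in_itv /=; exact: fc.
  have [] := @dominated_convergence _ _ _ mu `[a, t]%classic _
    (fun k => EFin \o f_ k) (EFin \o f) (cst c%:E).
  - by [].
  - by move=> k; apply/measurable_EFinP; exact: mf_.
  - apply/measurable_EFinP; exact: measurable_fun_cvg mf_ fct.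
  - by apply: aeW => x xt; apply/cvg_EFin; [exact: nearW|exact: fct].
  - apply: (intS tab); apply: cont_int; apply: cont_sub => x; exact: cvg_cst.
  - apply: aeW => x k /(sub_ab tab); rewrite /= in_itv /= => xab.
    by rewrite lee_fin; exact: fle.
  move=> fI _ fcv; split => //.
  apply: fine_cvg; rewrite fineK//; exact: integrable_fin_num.
(* Integrability on the whole interval is the case [t = b]. *)
split=> [|t /DC[]//].
by have [] := DC b; rewrite ?lexx ?ltW.
Qed.

(** The limit passes through [K] by two dominated convergences, under the inner and then the outer
    integral, both with majorant [m * e b]. *)
Let KvI : integrable_ab (fun x => Q x * v x) /\
  forall t, a <= t <= b -> v t = K v t.
Proof.
have le_e k x : a <= x <= b -> `|Q x * v_ k x| <= m * e b.
  move=> xab; have [_ /(_ x xab)/andP[v1 ve] _] := v_prop k.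
  rewrite ger0_norm ?mulr_ge0 ?(le_trans ler01 v1)//.
  apply: ler_pM => //; [exact: le_trans ler01 v1|exact: Q_le|].
  apply: (le_trans ve); rewrite ler_expR ler_pM2l// lerD2r.
  by case/andP: xab.
have Qvi k : integrable_ab (fun x => Q x * v_ k x).
  by apply: QI; have [] := v_prop k.
have [QvI JQv] := J_cvg Qvi
  (fun x xab => cvgM (cvg_cst (Q x)) (v_cvg xab)) le_e.
split => // t tab.
have JQle k x : a <= x <= b -> `|P x * J (fun y => Q y * v_ k y) x| <= m * e b.
  move=> xab; have v0 y : a <= y <= b -> 0 <= v_ k y.
    move=> yab; have [_ /(_ y yab)/andP[+ _] _] := v_prop k.
    exact: le_trans.
  have J0 : 0 <= J (fun y => Q y * v_ k y) x.
    by apply: J_ge0 => // y /v0; exact: mulr_ge0.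
  rewrite ger0_norm ?mulr_ge0//; apply: ler_pM => //; first exact: P_le.
  apply: (@le_trans _ _ (J (fun x => m * e x) x)).
    apply: J_le => //.
      apply/cont_int/cont_sub => y.
      by apply: continuousM; [exact: cvg_cst|exact: e_cont].
    move=> y yab; have [_ /(_ y yab)/andP[_ ve] _] := v_prop k.
    by apply: ler_pM => //; [exact: v0|exact: Q_le].
  rewrite J_e//; apply: (@le_trans _ _ (e x)); first by rewrite gerBl.
  by rewrite ler_expR ler_pM2l// lerD2r; case/andP: xab.
have [_ JPv] := J_cvg (fun k => KI (Qvi k))
  (fun x xab => cvgM (cvg_cst (P x)) (JQv x xab)) JQle.
(* The shifted sequence tends to [K v t] and, like the sequence itself, to [v t]. *)
have : v_ k.+1 t @[k --> \oo] --> K v t.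
  by apply: cvgD; [exact: cvg_cst|exact: JPv].
rewrite (cvg_shiftS (v_ ^~ t)).
by apply: cvg_unique (v_cvg tab); exact: norm_hausdorff.
Qed.

Let interior_derive f t : continuous_ab f -> a < t < b ->
  is_derive t (1 : R) (J f) (f t).
Proof.
move=> cf /andP[at_ tb].
have ft : {for t, continuous f}.
  apply: (within_continuous_continuous ab cf).
  by rewrite in_itv /= at_ tb.
have [Jd Jt] := @continuous_FTC1_closed R f a t b tb (cont_int cf) at_ ft.
by apply: DeriveDef; [exact: Jd|rewrite -derive1E; exact: Jt].
Qed.

Lemma volterra_solution : exists v g : R -> R, forall t, a < t < b ->
  [/\ 1 <= v t, is_derive t (1 : R) v (P t * g t) &
      is_derive t (1 : R) g (Q t * v t)].
Proof.
have [QvI vK] := KvI.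
(* So far [v] is only a pointwise limit; being equal to [K v], a constant plus an integral, it is
   continuous, as the fundamental theorem requires. *)
have vc : continuous_ab v.
  apply: subspace_eq_continuous (K_cont QvI) => t.
  by rewrite inE /= in_itv /= => /vK.
(* [K v] agrees with [v] on [[a, b]] and is an integral by definition, so its derivative is read off
   directly. *)
exists (K v), (J (fun x => Q x * v x)) => t tab.
have tab' : a <= t <= b by case/andP: tab => /ltW-> /ltW->.
rewrite -vK//; split; first by have /andP[] := v_itv tab'.
  have Pc : continuous_ab (fun x => P x * J (fun y => Q y * v y) x).
    by apply: within_continuousM; [exact: cP|exact: J_cont].
  have := is_deriveD (is_derive_cst (1 : R) t (1 : R)) (interior_derive Pc tab).
  by rewrite add0r; exact.
by apply: interior_derive => //; exact: within_continuousM.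
Qed.

End Volterra.

(** * A positive solution of the scalar equation *)

Section RealWithinDerivative.
Variables (R : realType) (D : set R) (t : R).
Implicit Types f g : R -> R.
Local Notation F := (within D t^').

Definition is_deriv_in f (l : R) := (s - t)^-1 * (f s - f t) @[s --> F] --> l.

Lemma is_deriv_in_cvg f l : is_deriv_in f l -> f s @[s --> F] --> f t.
Proof.
move=> fl.
have st : s - t @[s --> F] --> (0 : R).
  by rewrite -(subrr t); apply: cvgB; [exact: cvg_within_dnbhs|exact: cvg_cst].
have : f t + (s - t) * ((s - t)^-1 * (f s - f t)) @[s --> F] --> f t + 0 * l.
  by apply: cvgD; [exact: cvg_cst|exact: cvgM].
rewrite mul0r addr0; apply: cvg_trans; apply: near_eq_cvg.
have := near_within_dnbhs_neq D t; apply: filterS => s st0.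
by rewrite mulrA mulfV ?subr_eq0// mul1r subrKC.
Qed.

Lemma is_deriv_inD f g l k : is_deriv_in f l -> is_deriv_in g k ->
  is_deriv_in (fun s => f s + g s) (l + k).
Proof.
move=> fl gk; rewrite /is_deriv_in.
under eq_fun do rewrite opprD addrACA mulrDr.
exact: cvgD.
Qed.

Lemma is_deriv_inM f g l k : is_deriv_in f l -> is_deriv_in g k ->
  is_deriv_in (fun s => f s * g s) (l * g t + f t * k).
Proof.
move=> fl gk; rewrite /is_deriv_in.
have E s : (s - t)^-1 * (f s * g s - f t * g t) =
  (s - t)^-1 * (f s - f t) * g s + f t * ((s - t)^-1 * (g s - g t)) by ring.
under eq_fun do rewrite E.
apply: cvgD; apply: cvgM => //; last exact: cvg_cst.
exact: is_deriv_in_cvg gk.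
Qed.

Lemma is_deriv_inZ k f l : is_deriv_in f l ->
  is_deriv_in (fun s => k * f s) (k * l).
Proof.
move=> fl; rewrite /is_deriv_in.
under eq_fun do rewrite -mulrBr mulrCA.
by apply: cvgM => //; exact: cvg_cst.
Qed.

(** The substitution h = s - t is injective, so punctured neighbourhoods stay punctured; restricting
    to [D] preserves the limit. *)
Lemma is_derive_is_deriv_in f l : is_derive t (1 : R) f l -> is_deriv_in f l.
Proof.
move=> [fd fl].
have fdl : h^-1 *: (f (h *: (1 : R) + t) - f t) @[h --> 0^'] --> l.
  by rewrite -fl; exact: fd.
have st : s - t @[s --> t^'] --> 0^'.
  rewrite -(subrr t).
  apply: (@continuous_injective_withinNx R R (fun s => s - t)).
    by move=> ?; apply: cvgB; [exact: cvg_id|exact: cvg_cst].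
  by move=> y /addIr.
have := cvg_comp _ _ st fdl.
apply: cvg_trans; apply: cvg_trans; last exact: cvg_app (@cvg_within _ _ _ D).
apply: near_eq_cvg; apply: nearW => s /=.
by rewrite /GRing.scale /= mulr1 subrK.
Qed.

Lemma is_deriv_in_near f g l : D t -> (forall s, D s -> f s = g s) ->
  is_deriv_in f l -> is_deriv_in g l.
Proof.
move=> Dt fg; apply: cvg_trans; apply: near_eq_cvg.
have := near_withinT D (dnbhs_filter t); apply: filterS => s Ds.
by rewrite !fg.
Qed.

Lemma is_deriv_inP {PF : ProperFilter F} f l : is_deriv_in f l ->
  derivable_in D f t /\ deriv_in D f t = l.
Proof.
move=> fl; split; first by apply/cvg_ex; exists l.
exact: cvg_lim.
Qed.

Lemma cvg_within_nbhs f : f s @[s --> F] --> f t ->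
  f s @[s --> within D (nbhs t)] --> f t.
Proof.
move=> ft A nA.
have h : \forall s \near t, s != t -> D s -> A (f s) by exact: ft.
have : \forall s \near t, D s -> A (f s).
  apply: filterS h => s h Ds.
  have [->|] := eqVneq s t; last by move=> /h; exact.
  exact: nbhs_singleton.
exact.
Qed.

End RealWithinDerivative.

Section Clamp.
Variables (R : realType) (a b : R).
Hypothesis ab : a <= b.

(** Projection of the line onto [[a, b]]; composing with it extends a function beyond the interval
    by its endpoint values. *)
Definition clamp (t : R) : R := Num.max a (Num.min t b).

Lemma clamp_itv t : a <= clamp t <= b.
Proof. by rewrite /clamp le_max lexx /= ge_max ab ge_min lexx orbT. Qed.

Lemma clamp_id t : a <= t <= b -> clamp t = t.
Proof. by move=> /andP[at_ tb]; rewrite /clamp min_l// max_r. Qed.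

Lemma clamp_continuous : continuous clamp.
Proof.
move=> t; apply: (@continuous_max R R (cst a) (fun s => Num.min s b)).
  exact: cvg_cst.
apply: (@continuous_min R R idfun (cst b)); [exact: cvg_id|exact: cvg_cst].
Qed.

Lemma continuous_clamp (f : R -> R) :
  (forall t, a <= t <= b -> f s @[s --> within `[a, b]%classic t^'] --> f t) ->
  continuous (f \o clamp).
Proof.
move=> fc t.
have ft := cvg_within_nbhs (fc _ (clamp_itv t)).
apply: cvg_comp ft => A nA.
have : \forall s \near t, `[a, b]%classic (clamp s) -> A (clamp s).
  exact: (clamp_continuous nA).
apply: filterS => s; apply.
by rewrite /= in_itv /=; exact: clamp_itv.
Qed.

End Clamp.

Lemma positive_solution (R : realType) (a b : R) (w w' r : R -> R) :
  a < b ->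
  (forall t, a <= t <= b -> is_deriv_in `[a, b]%classic t w (w' t)) ->
  (forall t, a <= t <= b -> r s @[s --> within `[a, b]%classic t^'] --> r t) ->
  (forall t, a <= t <= b -> 0 <= r t) ->
  exists phi phi' : R -> R, forall t, a <= t <= b ->
    [/\ 0 < phi t, is_deriv_in `[a, b]%classic t phi (phi' t) &
      is_deriv_in `[a, b]%classic t phi' ((w' t + w t ^+ 2 + r t) * phi t)].
Proof.
move=> ab wd rc r0; set D := `[a, b]%classic.
have wc t : a <= t <= b -> w s @[s --> within D t^'] --> w t.
  by move=> tab; exact: is_deriv_in_cvg (wd t tab).
(* The data are extended and the integrals taken over [[a - 1, b + 1]], so that [a] and [b] become
   interior points, where the derivatives of [U], [v] and [g] are available. *)
pose W := w \o clamp a b; pose Q0 := r \o clamp a b.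
have Wc : continuous W by apply: continuous_clamp => //; exact: ltW.
have Q0c : continuous Q0 by apply: continuous_clamp => //; exact: ltW.
have ab1 : a - 1 < b + 1 by lra.
pose U t := \int[@lebesgue_measure R]_(x in `[a - 1, t]) W x.
have WI : (@lebesgue_measure R).-integrable `[a - 1, b + 1] (EFin \o W).
  apply: continuous_compact_integrable; first exact: segment_compact.
  exact: continuous_subspaceT.
have Uc : {within `[a - 1, b + 1], continuous U}.
  by apply: parameterized_integral_continuous => //; exact: ltW.
have Ud t : a <= t <= b -> is_derive t (1 : R) U (w t).
  move=> tab; have [t1 t2] : a - 1 < t /\ t < b + 1 by lra.
  have [Ud Ut] := continuous_FTC1_closed t2 WI t1 (Wc t).
  apply: DeriveDef; first exact: Ud.
  by rewrite -derive1E Ut /W /= clamp_id.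
pose u t := expR (U t); pose z t := expR (- U t).
have uz t : u t * z t = 1 by rewrite /u /z expRN mulfV// gt_eqF// expR_gt0.
have uc : {within `[a - 1, b + 1], continuous u}.
  by move=> t; apply: continuous_comp; [exact: Uc|exact: continuous_expR].
have zc : {within `[a - 1, b + 1], continuous z}.
  move=> t; apply: continuous_comp; last exact: continuous_expR.
  by apply: (@continuousN R R); exact: Uc.
have ud t : a <= t <= b -> is_derive t (1 : R) u (w t * u t).
  move=> /Ud dU; rewrite /u; apply: is_derive_eq.
  by rewrite /GRing.scale /= mulrC.
have zd t : a <= t <= b -> is_derive t (1 : R) z (- w t * z t).
  move=> /Ud dU; rewrite /z; apply: is_derive_eq.
  by rewrite /GRing.scale /= mulrC.
(* With g = u^2 v' and [z] = 1 / u, the equation (u^2 v')' = u^2 r v becomes v' = P g, g' = Q v. *)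
pose P t := z t * z t; pose Q t := u t * u t * Q0 t.
have Pc : {within `[a - 1, b + 1], continuous P}.
  exact: within_continuousM.
have Qc : {within `[a - 1, b + 1], continuous Q}.
  apply: within_continuousM; last exact: continuous_subspaceT.
  exact: within_continuousM.
have P0 t : 0 <= P t by rewrite mulr_ge0// expR_ge0.
have Q_ge0 t : 0 <= Q t.
  by rewrite !mulr_ge0 ?expR_ge0// /Q0 /= r0// clamp_itv// ltW.
have [c1 _ Pc1] := EVT_max (ltW ab1) Pc.
have [c2 _ Qc2] := EVT_max (ltW ab1) Qc.
(* The sum of the two maxima bounds both functions, as they are nonnegative; the [1] makes it
   positive. *)
pose m := P c1 + Q c2 + 1.
have m0 : 0 < m by rewrite /m ltr_wpDl// addr_ge0.
have Pm t : a - 1 <= t <= b + 1 -> P t <= m.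
  move=> tab; have := Pc1 t; rewrite in_itv /= tab => /(_ isT) Pt.
  by rewrite (le_trans Pt)// /m -addrA lerDl addr_ge0.
have Qm t : a - 1 <= t <= b + 1 -> Q t <= m.
  move=> tab; have := Qc2 t; rewrite in_itv /= tab => /(_ isT) Qt.
  by rewrite (le_trans Qt)// /m addrAC lerDr addr_ge0.
have [v [g vg]] := volterra_solution ab1 Pc Qc P0 Q_ge0 m0 Pm Qm.
exists (fun t => u t * v t), (fun t => w t * (u t * v t) + z t * g t) => t tab.
have [|v1 /(is_derive_is_deriv_in D) vd /(is_derive_is_deriv_in D) gd] := vg t.
  by lra.
have ud' := is_derive_is_deriv_in D (ud t tab).
have zd' := is_derive_is_deriv_in D (zd t tab).
have uvd := is_deriv_inM ud' vd.
have E1 : w t * u t * v t + u t * (P t * g t) = w t * (u t * v t) + z t * g t.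
  by rewrite /P -mulrA !(mulrA (u t)) uz mul1r.
rewrite E1 in uvd.
split => //.
  by rewrite mulr_gt0 ?expR_gt0// (lt_le_trans ltr01 v1).
have := is_deriv_inD (is_deriv_inM (wd t tab) uvd) (is_deriv_inM zd' gd).
congr (is_deriv_in _ _ _ _).
rewrite /Q /Q0 /= clamp_id//.
(* The terms w z g of the two products cancel; the rest is grouped so that [u t * z t] can be
   replaced by 1. *)
transitivity (w' t * (u t * v t) + w t ^+ 2 * (u t * v t) +
    (u t * z t) * (u t * (r t * v t))).
  ring.
rewrite uz; ring.
Qed.

(** * Algebra of the Riccati equation *)

(** Pure algebra: [As], [Fs], [Gs] stand for adjoints, [dS] and [dH] for derivatives. The left side
    is the trace of the derivative of Z + H with the Riccati equation for Y inserted, where B = S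
    S. *)
Lemma trace_riccati (K : numFieldType) n (S dS A As C Y F Fs dH : 'M[K]_n)
    (G := S *m As - dS) (Gs := A *m S - dS) (Z := S *m Y *m S)
    (H := 2^-1 *: (G *m F + Fs *m Gs)) :
  G = G *m F *m S -> Gs = S *m Fs *m Gs ->
  \tr ((dS *m Y + S *m (C - As *m Y - Y *m A - Y *m (S *m S) *m Y)) *m S +
       S *m Y *m dS + dH) =
  - \tr (- dH - H *m H - S *m S *m C) - \tr ((Z + H) *m (Z + H)).
Proof.
move=> GE GsE.
have -> : (dS *m Y + S *m (C - As *m Y - Y *m A - Y *m (S *m S) *m Y)) *m S +
    S *m Y *m dS = S *m C *m S - G *m Y *m S - S *m Y *m Gs - Z *m Z.
  rewrite /G /Gs /Z !(mulmxDl, mulmxDr, mulNmx, mulmxN, mulmxA).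
  (* The noncommutative products become atoms, leaving an additive identity for [ring]. *)
  move: (dS *m Y *m S) (S *m Y *m dS) (S *m C *m S) (S *m As *m Y *m S)
    (S *m Y *m A *m S) (S *m Y *m S *m S *m Y *m S) => x1 x2 x3 x4 x5 x6.
  by apply/matrixP => i j; rewrite !mxE; ring.
(* The equation for [G] supplies the factor [S] missing on the left of [Y *m S]. *)
have GYS : G *m Y *m S = G *m F *m Z by rewrite {1}GE /Z !mulmxA.
have SYG : S *m Y *m Gs = Z *m (Fs *m Gs) by rewrite {1}GsE /Z !mulmxA.
rewrite GYS SYG; clearbody G Gs; rewrite raddfD !raddfB raddfN /=.
have -> : \tr (S *m C *m S) = \tr (S *m S *m C) by rewrite mxtrace_mulC mulmxA.
rewrite mulmxDl !mulmxDr !raddfD /= (mxtrace_mulC H Z).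
(* By cyclicity the two terms linear in [Z] make up the cross term 2 tr(Z H) of the square. *)
have -> : \tr (Z *m H) = 2^-1 * (\tr (G *m F *m Z) + \tr (Z *m (Fs *m Gs))).
  by rewrite /H -scalemxAr linearZ mulmxDr raddfD /= (mxtrace_mulC Z (G *m F)).
by field.
Qed.

(** The difference of the two sides is tr((W - c)^2) / n with c = tr W / n, the variance of the
    eigenvalues. *)
Lemma hermitian_trace_sqr_ge (K : numClosedFieldType) n (W : 'M[K]_n) :
  (0 < n)%N -> W = W ^t* -> (\tr W / n%:R) ^+ 2 <= \tr (W *m W) / n%:R.
Proof.
move=> n_gt0 WH; set c := \tr W / n%:R.
have n0 : 0 < n%:R :> K by rewrite ltr0n.
have trJ : Num.conj (\tr W) = \tr W.
  by rewrite {2}WH /mxtrace rmorph_sum; apply: eq_bigr => i _; rewrite !mxE.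
have cJ : Num.conj c = c by rewrite /c rmorphM fmorphV rmorph_nat /= trJ.
pose M := W - c%:M.
have MH : M ^t* = M.
  apply/matrixP => i j; rewrite !mxE rmorphB rmorphMn /= cJ eq_sym.
  by rewrite {2}WH !mxE.
have : 0 <= \tr (M *m M).
  rewrite -{2}MH /mxtrace sumr_ge0// => i _; rewrite mxE sumr_ge0// => j _.
  by rewrite !mxE mul_conjC_ge0.
have -> : \tr (M *m M) = \tr (W *m W) - n%:R * c ^+ 2.
  rewrite /M mulmxBl !mulmxBr !raddfB /= mul_mx_scalar mul_scalar_mx.
  rewrite linearZ /= -scalar_mxM mxtrace_scalar.
  have -> : \tr W = n%:R * c by rewrite /c mulrC divfK// gt_eqF.
  by rewrite -mulr_natl; ring.
by rewrite subr_ge0 ler_pdivlMr// mulrC.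
Qed.

Lemma hermitian_trace_real (R : realType) n (M : 'M[R[i]]_n) :
  M = M ^t* -> (complex.Re (\tr M))%:C = \tr M.
Proof.
move=> MH; apply: RRe_real; apply/CrealP.
by rewrite {2}MH /mxtrace rmorph_sum; apply: eq_bigr => i _; rewrite !mxE.
Qed.

(** The left side is what the product and inverse rules give for the derivative of [Y] along the
    system. *)
Lemma riccati_rhs (K : comUnitRingType) n (A As B C Phi Psi : 'M[K]_n)
    (Y := Psi *m invmx Phi) :
  Phi \in unitmx ->
  (C *m Phi - As *m Psi) *m invmx Phi +
    Psi *m - (invmx Phi *m (A *m Phi + B *m Psi) *m invmx Phi) =
  C - As *m Y - Y *m A - Y *m B *m Y.
Proof.
move=> PhiU; rewrite /Y mulmxBl mulmxN mulmxDr mulmxDl mulmxDr.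
rewrite -!mulmxA mulmxV// !mulmx1 opprD !mulmxA.
by rewrite addrA.
Qed.

(** Multiply the relation by the inverse of [Phi ^t*] on the left and of [Phi] on the right. *)
Lemma prepared_quotient_herm (K : numClosedFieldType) n (Phi Psi : 'M[K]_n) :
  Phi \in unitmx -> Phi ^t* *m Psi = Psi ^t* *m Phi ->
  Psi *m invmx Phi = (Psi *m invmx Phi) ^t*.
Proof.
move=> PhiU prep; rewrite trmx_mul map_mxM.
have PV : (invmx Phi) ^t* *m Phi ^t* = 1%:M.
  by rewrite -map_mxM -trmx_mul mulmxV// trmx1 map_mx1.
rewrite -[in LHS](mul1mx Psi) -PV -(mulmxA _ _ Psi) prep -!mulmxA mulmxV//.
by rewrite mulmx1.
Qed.

Lemma trmxCD (K : numClosedFieldType) m n (M N : 'M[K]_(m, n)) :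
  (M + N) ^t* = M ^t* + N ^t*.
Proof. by rewrite raddfD map_mxD. Qed.

Lemma trmxCB (K : numClosedFieldType) m n (M N : 'M[K]_(m, n)) :
  (M - N) ^t* = M ^t* - N ^t*.
Proof. by rewrite raddfB map_mxB. Qed.

Lemma half_sum_herm (K : numClosedFieldType) n (M N : 'M[K]_n) :
  M ^t* = N -> 2^-1 *: (M + N) = (2^-1 *: (M + N)) ^t*.
Proof.
move=> <-; rewrite linearZ /= map_mxZ trmxCD trmxCK fmorphV rmorph_nat.
by rewrite addrC.
Qed.

Lemma real_complex_divn (R : realType) n (x : R) :
  (n%:R^-1 * x)%:C = x%:C / n%:R.
Proof. by rewrite rmorphM fmorphV rmorph_nat mulrC. Qed.

Lemma hermitian_sqr (K : numClosedFieldType) n (W : 'M[K]_n) :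
  W = W ^t* -> W *m W = (W *m W) ^t*.
Proof. by move=> WH; rewrite trmx_mul map_mxM -WH. Qed.

Lemma hermitian_Re_trace_sqr_ge (R : realType) n (W : 'M[R[i]]_n) :
  (0 < n)%N -> W = W ^t* ->
  (n%:R^-1 * complex.Re (\tr W)) ^+ 2 <= n%:R^-1 * complex.Re (\tr (W *m W)).
Proof.
move=> n_gt0 WH; rewrite -lecR rmorphXn /= !real_complex_divn.
rewrite (hermitian_trace_real WH) (hermitian_trace_real (hermitian_sqr WH)).
by have := hermitian_trace_sqr_ge n_gt0 WH; exact.
Qed.

(** Hermitian matrices have real traces, so the identity can be read in [R]. It serves with [V] =
    D_F, [M] = W' and [N] = W^2. *)
Lemma hermitian_trace_divn (R : realType) n (V M N : 'M[R[i]]_n) (k : nat) :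
  M = M ^t* -> N = N ^t* -> \tr M = - \tr V - \tr N ->
  \tr V / k%:R =
  (- (k%:R^-1 * complex.Re (\tr M) + k%:R^-1 * complex.Re (\tr N)))%:C.
Proof.
move=> MH NH MVN; rewrite -mulrDr -mulrN real_complex_divn rmorphN rmorphD /=.
rewrite (hermitian_trace_real MH) (hermitian_trace_real NH) MVN.
by rewrite subrK opprK.
Qed.

(** * The theorem *)

Theorem theorem2p5 (R : realType) (n : nat) (n_gt0 : (0 < n)%N) (t0 : R)
    (A B C : R -> 'M[R[i]]_n)
    (A_cont : {within `[t0, +oo[, continuous A})
    (B_cont : {within `[t0, +oo[, continuous B})
    (C_cont : {within `[t0, +oo[, continuous C})
    (B_herm : forall t, t0 <= t -> B t = B t ^t*)
    (C_herm : forall t, t0 <= t -> C t = C t ^t*)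
    (B_ge0 : forall t, t0 <= t -> nonneg_def (B t))
    (sqrtB_C1 : mx_C1_in `[t0, +oo[%classic (sqrtB B))
    (a b : R) (t0_le_a : t0 <= a) (a_lt_b : a < b)
    (H1 : forall t, a <= t <= b -> nonneg_def (B t))
    (F : R -> 'M[R[i]]_n)
    (H9_cont : {within `[a, b], continuous F})
    (H9_eq : forall t, a <= t <= b ->
       sqrtB B t *m A t ^t* - sqrtB' t0 B t =
       (sqrtB B t *m A t ^t* - sqrtB' t0 B t) *m F t *m sqrtB B t)
    (H9_C1 : mx_C1_in `[a, b]%classic
       (fun t => (sqrtB B t *m A t ^t* - sqrtB' t0 B t) *m F t +
                 F t ^t* *m (A t *m sqrtB B t - sqrtB' t0 B t)))
    (H10 : scalar_oscillatory a b
       (fun t => \tr (D_F t0 a b A B C F t) / n%:R)) :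
  hamiltonian_oscillatory t0 A B C a b.
Proof.
move=> Phi Psi [Phi_C1 Psi_C1 eqs] prep; apply: contrapT => Phi_nz.
set D := `[a, b]%classic; set D1 := `[t0, +oo[%classic in Phi_C1 Psi_C1 eqs.
have itvD t : D t = (a <= t <= b) :> Prop by rewrite /D /= in_itv.
have DD1 : D `<=` D1.
  move=> t; rewrite itvD /D1 /= in_itv /= andbT => /andP[+ _].
  exact: le_trans.
have D_ge t : D t -> t0 <= t by move=> /DD1; rewrite /D1 /= in_itv /= andbT.
have DF t : D t -> ProperFilter (within D t^').
  by rewrite itvD; exact: within_itv_proper.
have PhiU t : D t -> Phi t \in unitmx.
  move=> Dt; rewrite unitmxE unitfE; apply/eqP => P0; apply: Phi_nz.
  by exists t; rewrite -?itvD.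
have PhiD t : D t -> is_mx_deriv D t Phi (A t *m Phi t + B t *m Psi t).
  move=> Dt; rewrite -(eqs t (D_ge t Dt)).1.
  apply: (is_mx_deriv_subset DD1); exact: Phi_C1.1 (DD1 _ Dt).
have PsiD t : D t -> is_mx_deriv D t Psi (C t *m Phi t - A t ^t* *m Psi t).
  move=> Dt; rewrite -(eqs t (D_ge t Dt)).2.
  apply: (is_mx_deriv_subset DD1); exact: Psi_C1.1 (DD1 _ Dt).
pose S := sqrtB B; pose dS := sqrtB' t0 B.
have SD t : D t -> is_mx_deriv D t S (dS t).
  by move=> Dt; apply: (is_mx_deriv_subset DD1); exact: sqrtB_C1.1 (DD1 _ Dt).
have SH t : D t -> S t = S t ^t*.
  by move=> /D_ge/B_ge0/sqrtmxP[[]].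
have SS t : D t -> S t *m S t = B t.
  by move=> /D_ge/B_ge0/sqrtmxP[_].
have dSH t : D t -> dS t = dS t ^t*.
  by move=> Dt; have PF := DF t Dt; exact: is_mx_deriv_herm SH Dt (SD t Dt).
pose Y t := Psi t *m invmx (Phi t).
have YD t : D t -> is_mx_deriv D t Y
    (C t - A t ^t* *m Y t - Y t *m A t - Y t *m B t *m Y t).
  move=> Dt.
  have := is_mx_derivM (PsiD t Dt) (is_mx_deriv_inv PhiU Dt (PhiD t Dt)).
  by rewrite riccati_rhs ?PhiU//; exact.
have YH t : D t -> Y t = Y t ^t*.
  by move=> Dt; exact: prepared_quotient_herm (PhiU t Dt) (prep t (D_ge t Dt)).
pose G t := S t *m A t ^t* - dS t; pose Gs t := A t *m S t - dS t.
have GE t : D t -> G t = G t *m F t *m S t.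
  by rewrite itvD => tab; exact: H9_eq.
have GJ t : D t -> G t ^t* = Gs t.
  by move=> Dt; rewrite /G trmxCB trmxC_mul trmxCK -(SH t Dt) -(dSH t Dt).
(* Adjoint of the equation for [G], with [S] hermitian. *)
have GsE t : D t -> Gs t = S t *m F t ^t* *m Gs t.
  move=> Dt; rewrite -GJ// {1}(GE t Dt) !trmxC_mul -(SH t Dt).
  by rewrite mulmxA.
pose H := H_F t0 A B F.
have HH t : D t -> H t = H t ^t*.
  move=> Dt; apply: (half_sum_herm (M := G t *m F t)).
  by rewrite trmxC_mul GJ.
pose dH := mx_deriv_in D H.
(* [H] is one half of the function assumed continuously differentiable. *)
have HD t : D t -> is_mx_deriv D t H (dH t).
  move=> Dt; apply: mx_derivable_inP; apply: is_mx_derivP.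
  have Q := mx_derivable_inP (H9_C1.1 t Dt).
  exact: is_mx_derivZ Q.
pose Z t := S t *m Y t *m S t.
pose W t := Z t + H t.
(* The derivative of [Z], with [B] written as [S *m S] to match [trace_riccati]. *)
pose dZ t := (dS t *m Y t + S t *m (C t - A t ^t* *m Y t - Y t *m A t -
   Y t *m (S t *m S t) *m Y t)) *m S t + S t *m Y t *m dS t.
have WD t : D t -> is_mx_deriv D t W (dZ t + dH t).
  move=> Dt; rewrite /dZ SS//.
  have SYD := is_mx_derivM (SD t Dt) (YD t Dt).
  by have := is_mx_derivD (is_mx_derivM SYD (SD t Dt)) (HD t Dt); exact.
have WH t : D t -> W t = W t ^t*.
  move=> Dt; rewrite /W trmxCD -HH// /Z (trmxC_mul (S t *m Y t)).
  by rewrite (trmxC_mul (S t)) -SH// -YH// mulmxA.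
have trdW t : D t -> \tr (dZ t + dH t) =
    - \tr (D_F t0 a b A B C F t) - \tr (W t *m W t).
  move=> Dt; have := trace_riccati (C t) (Y t) (dH t) (GE t Dt) (GsE t Dt).
  by rewrite -/(dZ t) SS//; exact.
(* Hence the trace of W' is real, and taking its real part in [w'] loses nothing. *)
have dWH t : D t -> dZ t + dH t = (dZ t + dH t) ^t*.
  by move=> Dt; have PF := DF t Dt; exact: is_mx_deriv_herm WH Dt (WD t Dt).
pose w t := n%:R^-1 * complex.Re (\tr (W t)).
pose w' t := n%:R^-1 * complex.Re (\tr (dZ t + dH t)).
pose r t := n%:R^-1 * complex.Re (\tr (W t *m W t)) - w t ^+ 2.
have wd t : a <= t <= b -> is_deriv_in D t w (w' t).
  rewrite -itvD => Dt.
  exact: is_deriv_inZ (is_mx_deriv_Re_trace (WD t Dt)).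
have rc t : a <= t <= b -> r s @[s --> within D t^'] --> r t.
  rewrite -itvD => Dt; have Wc := is_mx_deriv_cvg (WD t Dt).
  have wc : w s @[s --> within D t^'] --> w t.
    by apply: is_deriv_in_cvg; apply: wd; rewrite -itvD.
  have WWc : complex.Re (\tr (W s *m W s)) @[s --> within D t^'] -->
      complex.Re (\tr (W t *m W t)).
    by have := cvgc_Re (cvg_mxtrace (cvg_mulmx Wc Wc)); exact.
  apply: cvgB; first by apply: cvgM; [exact: cvg_cst|exact: WWc].
  by apply: cvgM; exact: wc.
have r0 t : a <= t <= b -> 0 <= r t.
  rewrite -itvD => /WH WtH; rewrite subr_ge0.
  exact: hermitian_Re_trace_sqr_ge n_gt0 WtH.
(* The scalar equation thus reads phi'' = (w' + w^2 + r) phi. *)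
have qE t : D t -> \tr (D_F t0 a b A B C F t) / n%:R =
    (- (w' t + w t ^+ 2 + r t))%:C.
  move=> Dt; have -> : w' t + w t ^+ 2 + r t =
      w' t + n%:R^-1 * complex.Re (\tr (W t *m W t)) by rewrite /r; ring.
  have WWH := hermitian_sqr (WH t Dt).
  have := hermitian_trace_divn n (dWH t Dt) WWH (trdW t Dt).
  exact.
have [phi [phi' phiP]] := positive_solution a_lt_b wd rc r0.
have phiD t : D t -> deriv_in D phi t = phi' t.
  move=> Dt; have PF := DF t Dt; have := Dt; rewrite itvD => /phiP[_ pd _].
  by have [] := is_deriv_inP pd.
(* Oscillation would give a zero of the positive [phi]; it remains to check that [phi] is a
   solution. *)
have [|t tab phi0] := H10 phi; last first.
  by have [+ _ _] := phiP t tab; rewrite phi0 ltxx.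
move=> t tab; have [_ pd pd'] := phiP t tab.
have Dt : D t by rewrite itvD.
have PF := DF t Dt.
(* [deriv_in D phi] is known to be [phi'] only on [D], which suffices for a derivative within
   [D]. *)
have := is_deriv_in_near Dt (fun s Ds => esym (phiD s Ds)) pd'.
move=> /is_deriv_inP[d2 d2E].
split; [exact: (is_deriv_inP pd).1|exact: d2|].
rewrite [X in X%:C]d2E qE// -rmorphM -rmorphD /=.
by rewrite mulNr subrr.
Qed.
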